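(* Let $G$ be a countable monoid and let $X,Y$ be algebraic varieties over an uncountable algebraically closed field $k$. Let $A=X(k)$ and $B=Y(k)$. Suppose that $\tau \colon A^G \to B^G$ is an injective algebraic cellular automaton. Then $\tau(A^G)$ is a subshift of finite type of $B^G$.
   Context: Let $G$ be a monoid and $A$ a set. $G$ acts on $A^G$ by $(g\star x)(h)=x(hg)$ for $g,h\in G$, $x\in A^G$. For a subset $\Sigma\subset A^G$ and $E\subset G$, $\Sigma_E=\{x|_E : x\in\Sigma\}\subset A^E$. A subshift of finite type of $A^G$ is a subset of the form $\Sigma(A^G;D,P)=\{x\in A^G : (g\star x)|_D\in P \text{ for all } g\in G\}$ with $D\subset G$ finite and $P\subset A^D$. An algebraic variety over $k$ is a reduced $k$-scheme of finite type; it is identified with its set of $k$-points. A map $\tau\colon A^G\to B^G$ (with $A=X(k)$, $B=Y(k)$) is an algebraic cellular automaton if there are a finite set $M\subset G$ and a morphism of algebraic varieties $\mu\colon A^M\to B$ over $k$ with $\tau(x)(g)=\mu((g\star x)|_M)$ for all $x\in A^G$, $g\in G$. *)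

(* Defs.v *)
From HB Require Import structures.
From mathcomp Require Import all_boot all_algebra finmap.
From mathcomp Require Import boolp classical_sets functions cardinality.

Set Implicit Arguments.
Unset Strict Implicit.
Unset Printing Implicit Defensive.

Import GRing.Theory.
Local Open Scope classical_set_scope.
Local Open Scope ring_scope.

(* Schemes over k are defined through their functors of points, following      *)
(* Demazure and Gabriel: a k-scheme is a covariant functor from commutative    *)
(* k-algebras to types which is a sheaf for the Zariski topology and has an    *)
(* open cover by affine schemes; morphisms of k-schemes are natural            *)
(* transformations, and fibre products over k are computed pointwise.          *)
(* The algebras of [comAlgType k] are nonzero.  Nothing is lost: a Zariski     *)
(* sheaf takes exactly one value on the zero algebra (empty cover), and the    *)
(* conditions below hold vacuously there.                                      *)

Lemma lrmorphism_ext (k : fieldType) (R S : comAlgType k)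
  (f g : {lrmorphism R -> S}) : f =1 g -> f = g.
Proof.
case: f => f [[af] [mf] [sf]]; case: g => g [[ag] [mg] [sg]] /= fg.
have e : f = g by apply/funext.
case: _ / e ag mg sg fg => ag mg sg _.
by rewrite (Prop_irrelevance af ag) (Prop_irrelevance mf mg)
  (Prop_irrelevance sf sg).
Qed.

Record kfunctor (k : fieldType) := KFunctor {
  fobj :> comAlgType k -> Type;
  fmap : forall R S : comAlgType k, {lrmorphism R -> S} -> fobj R -> fobj S;
  fmap_id : forall (R : comAlgType k) (x : fobj R),
    fmap (idfun : {lrmorphism R -> R}) x = x;
  fmap_comp : forall (R S T : comAlgType k) (g : {lrmorphism S -> T})
    (f : {lrmorphism R -> S}) (x : fobj R),
    fmap (g \o f : {lrmorphism R -> T}) x = fmap g (fmap f x) }.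
Arguments fmap {k} k0 {R S} f x : rename.

Record morphism (k : fieldType) (F H : kfunctor k) := Morphism {
  mor :> forall R : comAlgType k, F R -> H R;
  mor_nat : forall (R S : comAlgType k) (f : {lrmorphism R -> S}) (x : F R),
    mor (fmap F f x) = fmap H f (mor x) }.

Definition kpoints (k : fieldType) (F : kfunctor k) : Type := F (k^o).

Section Spec.
Variables (k : fieldType) (A : comAlgType k).

Definition Spec_map (R S : comAlgType k) (f : {lrmorphism R -> S})
  (x : {lrmorphism A -> R}) : {lrmorphism A -> S} := f \o x.

Lemma Spec_map_id (R : comAlgType k) (x : {lrmorphism A -> R}) :
  Spec_map (idfun : {lrmorphism R -> R}) x = x.
Proof. exact: lrmorphism_ext. Qed.

Lemma Spec_map_comp (R S T : comAlgType k) (g : {lrmorphism S -> T})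
    (f : {lrmorphism R -> S}) (x : {lrmorphism A -> R}) :
  Spec_map (g \o f : {lrmorphism R -> T}) x = Spec_map g (Spec_map f x).
Proof. exact: lrmorphism_ext. Qed.

Definition Spec : kfunctor k := KFunctor Spec_map_id Spec_map_comp.

End Spec.

(* The fibre product over k of copies of F indexed by I. *)
Section Power.
Variables (k : fieldType) (F : kfunctor k) (I : Type).

Definition power_map (R S : comAlgType k) (f : {lrmorphism R -> S})
  (x : I -> F R) : I -> F S := fun i => fmap F f (x i).

Lemma power_map_id (R : comAlgType k) (x : I -> F R) :
  power_map (idfun : {lrmorphism R -> R}) x = x.
Proof. by apply/funext => i; exact: fmap_id. Qed.

Lemma power_map_comp (R S T : comAlgType k) (g : {lrmorphism S -> T})
    (f : {lrmorphism R -> S}) (x : I -> F R) :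
  power_map (g \o f : {lrmorphism R -> T}) x = power_map g (power_map f x).
Proof. by apply/funext => i; exact: fmap_comp. Qed.

Definition power : kfunctor k :=
  @KFunctor k (fun R => I -> F R) power_map power_map_id power_map_comp.

End Power.

(* The ideal generated by E is the whole ring. *)
Definition unit_ideal (R : comNzRingType) (E : set R) : Prop :=
  exists s : seq (R * R),
    (forall p, p \in s -> E p.2) /\ \sum_(p <- s) p.1 * p.2 = 1.

(* l exhibits S as the localization of R at the powers of a. *)
Definition is_localization (k : fieldType) (R S : comAlgType k) (a : R)
    (l : {lrmorphism R -> S}) : Prop :=
  [/\ exists b : S, l a * b = 1,
      forall s : S, exists r n, s * l a ^+ n = l r
    & forall r : R, l r = 0 -> exists n, a ^+ n * r = 0].

(* Agreement of x i and x j on the overlap is expressed on every algebra T     *)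
(* receiving both S i and S j over R, since such T factor through the          *)
(* localization of R at a i * a j.                                             *)
Definition zariski_sheaf (k : fieldType) (F : kfunctor k) : Prop :=
  forall (R : comAlgType k) (n : nat) (a : 'I_n -> R)
    (S : 'I_n -> comAlgType k) (l : forall i, {lrmorphism R -> S i}),
    unit_ideal (range a) ->
    (forall i, is_localization (a i) (l i)) ->
    forall x : forall i, F (S i),
      (forall i j (T : comAlgType k)
         (u : {lrmorphism S i -> T}) (v : {lrmorphism S j -> T}),
         u \o l i =1 v \o l j -> fmap F u (x i) = fmap F v (x j)) ->
      exists! z : F R, forall i, fmap F (l i) z = x i.

(* A monomorphism whose image is an open subfunctor: its pullback along any    *)
(* x : Spec R -> H is the complement of the closed subscheme defined by some   *)
(* subset E of R, i.e. f : R -> S lies in it iff f(E) generates the unit ideal.*)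
Definition open_immersion (k : fieldType) (F H : kfunctor k)
    (j : morphism F H) : Prop :=
  (forall R : comAlgType k, injective (@mor _ _ _ j R)) /\
  forall (R : comAlgType k) (x : H R), exists E : set R,
    forall (S : comAlgType k) (f : {lrmorphism R -> S}),
      range (@mor _ _ _ j S) (fmap H f x) <-> unit_ideal (f @` E).

Definition is_field (R : comNzRingType) : Prop :=
  forall a : R, a != 0 -> exists b : R, a * b = 1.

Definition reduced (R : comNzRingType) : Prop :=
  forall (a : R) (n : nat), a ^+ n = 0 -> a = 0.

Definition finitely_generated (k : fieldType) (A : comAlgType k) : Prop :=
  exists s : seq A, forall S : {pred A},
    GRing.subalg_closed S -> {subset s <= S} -> forall a : A, a \in S.

(* A reduced k-scheme of finite type (not necessarily separated).  As usual,   *)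
(* open subfunctors cover as soon as they cover the points with values in      *)
(* fields.                                                                     *)
Record variety (k : fieldType) := Variety {
  var_functor :> kfunctor k;
  var_sheaf : zariski_sheaf var_functor;
  var_cover : exists (n : nat) (A : 'I_n -> comAlgType k)
      (j : forall i, morphism (Spec (A i)) var_functor),
    (forall i, [/\ reduced (A i), finitely_generated (A i)
                 & open_immersion (j i)]) /\
    forall K : comAlgType k, is_field K ->
      forall x : var_functor K, exists i, range (@mor _ _ _ (j i) K) x }.

Section Shifts.
Variables (G : monoidType) (A : Type).

Definition shift (g : G) (x : G -> A) : G -> A := fun h => x (h * g)%g.

Definition restr (E : {fset G}) (x : G -> A) : E -> A := fun e => x (val e).
Arguments restr E x _ : clear implicits.

Definition SFT (D : {fset G}) (P : set (D -> A)) : set (G -> A) :=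
  [set x | forall g, P (restr D (shift g x))].

Definition is_SFT (Sigma : set (G -> A)) : Prop :=
  exists (D : {fset G}) (P : set (D -> A)), Sigma = SFT P.

End Shifts.
Arguments restr {G A} E x _.

Definition algebraic_cellular_automaton (G : monoidType) (k : fieldType)
    (X Y : variety k) (tau : (G -> kpoints X) -> (G -> kpoints Y)) : Prop :=
  exists (M : {fset G}) (mu : morphism (power X M) Y),
    forall (x : G -> kpoints X) (g : G),
      tau x g = mu (k^o) (restr M (shift g x)).

(* Main.v *)
From HB Require Import structures.
From mathcomp Require Import all_boot all_algebra finmap.
From mathcomp Require Import boolp classical_sets functions cardinality filter.
From mathcomp Require Import ring.
(* Loaded last, so that fmap is the action of a k-functor on morphisms and not *)
(* the image of a filter.                                                      *)
Require Import Defs.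

Set Implicit Arguments.
Unset Strict Implicit.
Unset Printing Implicit Defensive.

Import GRing.Theory.
Local Open Scope classical_set_scope.
Local Open Scope ring_scope.

(** The image of [tau] is of finite type as soon as the inverse of [tau] is
    locally determined: there is a finite [N] such that [tau x] restricted to
    [N] determines [x] at the identity ([local_determination]).  Indeed, if [y]
    looks like an element of the image on every translate of a finite window
    containing 1, [N] and [N * M], where [M] is the memory set, then the values
    at 1 of the local preimages of [y] agree with each other on translates of
    [M], and assemble into a global preimage of [y] ([range_SFT]).

    Local determination is a compactness statement.  If it fails, every finite
    [N] carries two configurations with distinct values at 1 whose images agree
    on [N].  The solution sought is one pair of configurations with distinct
    values at 1 and equal images, against injectivity.  It is found by
    [saturation]: given an ultrafilter on a family of points of [X^I], with [I]
    countable, and countably many equations between morphisms from finite powers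
    of [X], there is a single point of [X^I] satisfying exactly those equations
    that hold almost everywhere along the family.

    For [saturation], almost all members of the family have their [i]-th
    component in one affine chart ([ultra_chart]), so that the affine coordinates
    of the components generate a subalgebra [R] of the functions on the parameter
    set.  It is countably generated, and the functions that vanish almost
    everywhere form a prime ideal of [R].  Two ingredients remain.
    - For two points of a variety over a finitely generated algebra [Q], whether
      they coincide almost everywhere along a family of rational points of [Q]
      decides whether they coincide at every rational point of the zero locus of
      the corresponding prime ideal, off one hypersurface that does not contain
      this locus ([generic_eq]).  This stands for the constructibility of
      equality, on possibly nonseparated varieties; it rests on Hilbert's basis
      theorem, since open subsets of the spectrum of [Q] have to be quasi-compact.
    - A countably generated algebra over an uncountable algebraically closed field
      has a rational point in the zero locus of a prime ideal and off countably
      many given hypersurfaces, none of which contains this locus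
      ([countable_nullstellensatz]).
    A rational point of [R] chosen off the hypersurfaces given by [generic_eq]
    specializes the coordinates to the point sought. *)

(** * Function algebras, subalgebras and lifting of morphisms *)

Lemma lrmorphism_of_fun (k : fieldType) (A B : comAlgType k) (f : A -> B) :
  {morph f : x y / x + y} -> monoid_morphism f -> scalable f ->
  exists g : {lrmorphism A -> B}, g =1 f.
Proof.
move=> fD fM fZ.
have f0 : f 0 = 0 by rewrite -[X in f X](scale0r (0 : A)) fZ scale0r.
pose m1 := GRing.isNmodMorphism.Build A B f (conj f0 fD).
pose m2 := GRing.isMonoidMorphism.Build A B f fM.
pose m3 := GRing.isScalable.Build k A B _ f fZ.
pose g : {lrmorphism A -> B} := HB.pack f m1 m2 m3.
by exists g.
Qed.

Section FunctionAlgebra.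
Variables (k : fieldType) (T : pointedType).

Let fct_scalerAl (a : k) (f g : T -> k^o) : a *: (f * g) = (a *: f) * g.
Proof. by apply/funext => t; exact: mulrA. Qed.

#[local] HB.instance Definition _ :=
  @GRing.Lmodule_isLalgebra.Build k (T -> k^o) fct_scalerAl.
#[local] HB.instance Definition _ :=
  @GRing.Lalgebra_isComAlgebra.Build k (T -> k^o).

Definition fct_comAlg : comAlgType k := (T -> k^o : Type).

Lemma fct_eval_lrmorphism (t : T) :
  exists e : {lrmorphism fct_comAlg -> k^o}, forall f : T -> k, e f = f t.
Proof.
by have [//|//|//|e eE] := @lrmorphism_of_fun k fct_comAlg k^o (fun f => f t); exists e.
Qed.

End FunctionAlgebra.

(** The algebra of all functions [T -> k], known only through its evaluations:
    they are jointly injective, and every function occurs.  Hiding the carrier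
    keeps the type of points [T] free of any structure. *)
Lemma function_algebra (k : fieldType) (T : Type) : inhabited T ->
  exists (P : comAlgType k) (ev : T -> {lrmorphism P -> k^o}),
    (forall f g, (forall t, ev t f = ev t g) -> f = g) /\
    (forall h : T -> k, exists f, forall t, ev t f = h t).
Proof.
case=> t0; pose cT : choiceType := HB.pack T (gen_eqMixin T) (gen_choiceMixin T).
pose pT : pointedType := HB.pack T cT (isPointed.Build T t0).
have [ev evE] := choice (@fct_eval_lrmorphism k pT).
exists (fct_comAlg k pT), ev; split=> [f g fg|h]; last by exists h => t; exact: evE.
by apply/funext => t; have := fg t; rewrite !evE.
Qed.

(** A family of rational points of [Q] indexed by [T] is the same as a morphism
    from [Q] to the functions on [T]. *)
Lemma function_algebra_lift (k : fieldType) (T : Type) (P Q : comAlgType k)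
    (ev : T -> {lrmorphism P -> k^o}) (p : T -> {lrmorphism Q -> k^o}) :
  (forall f g, (forall t, ev t f = ev t g) -> f = g) ->
  (forall h : T -> k, exists f, forall t, ev t f = h t) ->
  exists h : {lrmorphism Q -> P}, forall t q, ev t (h q) = p t q.
Proof.
move=> ev_inj ev_surj; have [h hE] := choice (fun q => ev_surj (fun t => p t q)).
have [|||g gE] := @lrmorphism_of_fun k Q P h.
- by move=> x y; apply: ev_inj => t; rewrite hE !rmorphD/= !hE.
- split=> [|x y]; apply: ev_inj => t; first by rewrite hE !rmorph1.
  by rewrite hE !rmorphM/= !hE.
- by move=> c x; apply: ev_inj => t; rewrite hE !linearZ/= hE.
by exists g => t q; rewrite gE.
Qed.

Section Subalgebra.
Variables (k : fieldType) (A : comAlgType k) (S : {pred A}).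
Hypothesis algS : GRing.subalg_closed S.

Definition subalg of GRing.subalg_closed S : predArgType := {a : A | a \in S}.
#[local] HB.instance Definition _ :=
  [isSub of subalg algS for @sval A (fun a => a \in S)].
#[local] HB.instance Definition _ := [Choice of subalg algS by <:].
#[local] HB.instance Definition _ :=
  GRing.SubChoice_isSubAlgebra.Build k A S (subalg algS) algS.
#[local] HB.instance Definition _ :=
  GRing.SubNzRing_isSubComNzRing.Build A S (subalg algS).

(** The subalgebra is known only through its inclusion [i]. *)
Lemma subalgebra : exists (B : comAlgType k) (i : {lrmorphism B -> A}),
  [/\ injective i, forall b, i b \in S & forall a, a \in S -> exists b, i b = a].
Proof.
have [|||i iE] := @lrmorphism_of_fun k (subalg algS) A val.
- by move=> x y; rewrite raddfD.
- by split=> [|x y]; [exact: rmorph1|exact: rmorphM].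
- by move=> a x; rewrite linearZ.
exists (subalg algS), i; split=> [x y|b|a Sa]; first by rewrite !iE => /val_inj.
  by rewrite iE; exact: valP.
by exists (Sub a Sa : subalg algS); rewrite iE SubK.
Qed.

End Subalgebra.

Lemma lrmorphism_lift (k : fieldType) (A B C : comAlgType k)
    (i : {lrmorphism B -> A}) (f : {lrmorphism C -> A}) :
  injective i -> (forall c, exists b, i b = f c) ->
  exists g : {lrmorphism C -> B}, forall c, i (g c) = f c.
Proof.
move=> i_inj /choice[h hE].
have [|||g gE] := @lrmorphism_of_fun k C B h.
- by move=> x y; apply: i_inj; rewrite hE !rmorphD/= !hE.
- split=> [|x y]; apply: i_inj; first by rewrite hE !rmorph1.
  by rewrite hE !rmorphM/= !hE.
- by move=> a x; apply: i_inj; rewrite hE !linearZ/= hE.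
by exists g => c; rewrite gE.
Qed.

(** * Noetherian rings *)

Section Noetherian.
Variable R : comNzRingType.

Definition is_ideal (I : set R) : Prop :=
  [/\ I 0, forall x y, I x -> I y -> I (x + y) & forall a x, I x -> I (a * x)].

Definition ideal_gen (s : seq R) : set R :=
  [set x | forall J, is_ideal J -> [set` s] `<=` J -> J x].

Definition noetherian : Prop :=
  forall I, is_ideal I -> exists2 s : seq R, [set` s] `<=` I & I `<=` ideal_gen s.

Lemma ideal_gen_ideal s : is_ideal (ideal_gen s).
Proof.
split=> [J [J0 _ _] //|x y Ix Iy J idJ sJ|a x Ix J idJ sJ]; have [_ JD JM] := idJ.
  by apply: JD; [exact: Ix|exact: Iy].
by apply: JM; exact: Ix.
Qed.

Lemma sub_ideal_gen s : [set` s] `<=` ideal_gen s.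
Proof. by move=> x sx J _; apply. Qed.

Lemma ideal_gen_mono s t : {subset s <= t} -> ideal_gen s `<=` ideal_gen t.
Proof. by move=> st x + J idJ tJ; apply=> // y /st; exact: tJ. Qed.

Lemma idealB (I : set R) x y : is_ideal I -> I x -> I y -> I (x - y).
Proof. by case=> _ ID IM Ix Iy; apply: ID => //; rewrite -mulN1r; exact: IM. Qed.

End Noetherian.

Lemma noetherian_surj (Q R : comNzRingType) (f : {rmorphism Q -> R}) :
  (forall y, exists x, f x = y) -> noetherian Q -> noetherian R.
Proof.
move=> fsurj noeQ I [I0 ID IM].
have preim J : is_ideal J -> is_ideal (f @^-1` J).
  case=> J0 JD JM; split=> [|x y Jx Jy|a x Jx]; rewrite /preimage/=.
  - by rewrite rmorph0.
  - by rewrite rmorphD; exact: JD.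
  - by rewrite rmorphM; exact: JM.
have [s sI Is] := noeQ _ (preim I (And3 I0 ID IM)).
exists [seq f x | x <- s] => [_ /= /mapP[x /sI Ix ->] //|y Iy J idJ sJ].
have [x xy] := fsurj y; rewrite -xy.
apply: (Is x) (preim J idJ) _; first by rewrite /preimage/= xy.
by move=> z sz; apply: sJ; exact: map_f.
Qed.

(** Hilbert's basis theorem.  In an ideal that is not finitely generated, pick
    successively [f n] of least size outside the ideal of the previous ones; the
    leading coefficient of some [f n] lies in the ideal of the previous leading
    coefficients, and a combination [g] of the previous polynomials then has the
    leading term of [f n], so that [f n - g] contradicts minimality. *)
Lemma noetherian_poly (R : comNzRingType) : noetherian R -> noetherian {poly R}.
Proof.
move=> noeR I idI; apply: contrapT => nfg.
have ex_min s : exists f, [set` s] `<=` I -> [/\ I f, ~ ideal_gen s f &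
    forall g, I g -> ~ ideal_gen s g -> (size f <= size g)%N].
  have [sI|] := pselect ([set` s] `<=` I); last by move=> nsI; exists 0.
  have [f0 If0 nf0] : exists2 f, I f & ~ ideal_gen s f.
    apply: contrapT => nex; apply: nfg; exists s => // f If.
    by apply: contrapT => nf; apply: nex; exists f.
  pose P n := `[< exists f, [/\ I f, ~ ideal_gen s f & size f = n] >].
  have exP : exists n, P n by exists (size f0); apply/asboolP; exists f0.
  case: (ex_minnP exP) => n /asboolP[f [If nf <-]] nmin; exists f => _; split=> //.
  by move=> g Ig ng; apply: nmin; apply/asboolP; exists g.
have [next nextP] := choice ex_min.
pose S n := iter n (fun s => next s :: s) [::].
pose f n := next (S n).
have SS n : S n.+1 = f n :: S n by [].
have SI n : [set` S n] `<=` I.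
  elim: n => [//|n IHn] g; rewrite SS /= inE => /predU1P[->|/IHn //].
  by have [] := nextP _ IHn.
have fI n : I (f n) by have [] := nextP _ (SI n).
have fS n : ~ ideal_gen (S n) (f n) by have [] := nextP _ (SI n).
have fmin n g : I g -> ~ ideal_gen (S n) g -> (size (f n) <= size g)%N.
  by have [_ _] := nextP _ (SI n); exact.
have genI n : ideal_gen (S n) `<=` I by move=> g; apply; [exact: idI|exact: SI].
have Smono m n : (m <= n)%N -> {subset S m <= S n}.
  move=> /subnK <-; elim: (n - m)%N => [//|d IHd] g /IHd Sg.
  by rewrite addSn SS inE Sg orbT.
have S_f n g : g \in S n -> exists2 i, (i <= n)%N & g = f i.
  elim: n => [//|n IHn]; rewrite SS inE => /predU1P[->|]; first by exists n.
  by move=> /IHn[i le_in ->]; exists i => //; exact: leqW.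
pose lc n := [seq lead_coef g | g <- S n].
have lcmono m n : (m <= n)%N -> ideal_gen (lc m) `<=` ideal_gen (lc n).
  move=> /Smono mn; apply: ideal_gen_mono => _ /mapP[g /mn Sg ->]; exact: map_f.
pose L : set R := \bigcup_n ideal_gen (lc n).
have idL : is_ideal L.
  split=> [|x y [m _ Lx] [n _ Ly]|a x [n _ Lx]].
  - by exists 0%N => //; have [] := ideal_gen_ideal (lc 0%N).
  - exists (maxn m n) => //; have [_ + _] := ideal_gen_ideal (lc (maxn m n)).
    by apply; [apply: lcmono Lx|apply: lcmono Ly]; rewrite (leq_maxl, leq_maxr).
  - by exists n => //; have [_ _] := ideal_gen_ideal (lc n); exact.
have [s sL Ls] := noeR L idL.
have [n sn] : exists n, [set` s] `<=` ideal_gen (lc n).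
  elim: s sL {Ls} => [|x s IHs] sL; first by exists 0%N.
  have [|n sn] := IHs; first by move=> y sy; apply: sL; rewrite /= inE sy orbT.
  have [|m _ xm] := sL x; first by rewrite /= inE eqxx.
  exists (maxn m n) => y /=; rewrite inE => /predU1P[->|/sn].
    by apply: lcmono xm; rewrite leq_maxl.
  by apply: lcmono; rewrite leq_maxr.
have lead_n : ideal_gen (lc n) (lead_coef (f n)).
  apply: Ls (ideal_gen_ideal _) sn; exists n.+1 => //; apply: sub_ideal_gen.
  by rewrite /= /lc SS /= inE eqxx.
have fn0 : f n != 0.
  by apply/eqP => f0; apply: (fS n); rewrite f0; have [] := ideal_gen_ideal (S n).
(* The coefficients, at the leading degree of [f n], of the elements of degree *)
(* at most that of [f n] in the ideal of the previous polynomials.             *)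
pose J := [set c | exists g, [/\ ideal_gen (S n) g, (size g <= size (f n))%N &
                               g`_(size (f n)).-1 = c]].
have idJ : is_ideal J.
  have [i0 iD iM] := ideal_gen_ideal (S n).
  split=> [|x y [g [Sg szg <-]] [h [Sh szh <-]]|a x [g [Sg szg <-]]].
  - by exists 0; rewrite size_poly0 coef0.
  - exists (g + h); rewrite coefD; split=> //; first exact: iD.
    by rewrite (leq_trans (size_polyD _ _))// geq_max szg.
  - exists (a%:P * g); rewrite coefCM; split=> //; first exact: iM.
    by rewrite mul_polyC (leq_trans (size_scale_leq _ _)).
have [g [Sg szg lead_g]] : J (lead_coef (f n)).
  apply: lead_n idJ _ => _ /= /mapP[h Sh ->].
  have [i le_in hE] := S_f _ _ Sh.
  have szh : (size h <= size (f n))%N.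
    rewrite hE; apply: fmin => // fi; apply: (fS n).
    by apply: ideal_gen_mono fi; exact: Smono.
  have h0 : h != 0.
    apply/eqP => h0; apply: (fS i); rewrite -hE h0.
    by have [] := ideal_gen_ideal (S i).
  exists ('X^(size (f n) - size h) * h); split.
  - by have [_ _] := ideal_gen_ideal (S n); apply; exact: sub_ideal_gen.
  - by rewrite mulrC size_mulXn// subnK.
  - rewrite coefXnM lead_coefE ltnNge.
    have := size_poly_gt0 h; rewrite h0 => hgt0.
    have -> : (size (f n) - size h <= (size (f n)).-1)%N.
      by rewrite -subn1 leq_sub2l.
    congr (_ `_ _); rewrite -!subn1 -subnDA addnC subnDA subKn//.
have szlt : (size (f n - g)%R < size (f n))%N.
  rewrite -(prednK (n := size (f n))) ?size_poly_gt0// ltnS.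
  apply/leq_sizeP => j; rewrite leq_eqVlt => /predU1P[<-|lt_j].
    by rewrite coefB lead_g lead_coefE subrr.
  have le_j : (size (f n) <= j)%N by rewrite -(prednK (n := size (f n))) ?size_poly_gt0.
  by rewrite coefB !nth_default ?subrr// (leq_trans szg).
have : (size (f n) <= size (f n - g)%R)%N.
  apply: fmin; first exact: idealB idI (fI n) (genI _ _ Sg).
  move=> Sfg; apply: (fS n); have [_ iD _] := ideal_gen_ideal (S n).
  by rewrite -(subrK g (f n)); exact: iD.
by rewrite leqNgt szlt.
Qed.

Lemma noetherian_field (k : fieldType) : noetherian k.
Proof.
move=> I [I0 _ IM]; have [[x Ix x0]|nx] := pselect (exists2 x, I x & x != 0).
  exists [:: x] => [y /=|y _ J [_ _ JM] sJ]; first by rewrite inE => /eqP->.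
  by rewrite -(divfK x0 y); apply: JM; apply: sJ; rewrite /= inE.
exists [::] => [//|y Iy J [J0 _ _] _].
by have [->//|y0] := eqVneq y 0; case: nx; exists y.
Qed.

(** A finitely generated algebra is a quotient of an iterated polynomial ring
    over [k]. *)
Lemma noetherian_fg (k : fieldType) (A : comAlgType k) :
  finitely_generated A -> noetherian A.
Proof.
case=> s genA.
have [Q [f [noeQ fk fs]]] : exists (Q : comNzRingType) (f : {rmorphism Q -> A}),
    [/\ noetherian Q, forall c : k, exists x, f x = c%:A
      & forall a, a \in s -> exists x, f x = a].
  elim: s {genA} => [|a s [Q [f [noeQ fk fs]]]].
    exists k, (in_alg A : {rmorphism k -> A}); split=> //; first exact: noetherian_field.
    by move=> c; exists c.
  have cfa : commr_rmorph f a by move=> x; exact: mulrC.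
  exists {poly Q}, (horner_morph cfa : {rmorphism _ -> _}).
  split=> [|c|b]; first exact: noetherian_poly.
    by have [x <-] := fk c; exists x%:P; exact: horner_morphC.
  rewrite inE => /predU1P[->|/fs[x <-]]; first by exists 'X; exact: horner_morphX.
  by exists x%:P; exact: horner_morphC.
apply: noetherian_surj noeQ => a; apply/asboolP.
apply: (genA (fun a => `[< exists x, f x = a >])) => [|b /fs fb]; last exact/asboolP.
split=> [|c x y /asboolP[x' <-] /asboolP[y' <-]|x y /asboolP[x' <-] /asboolP[y' <-]].
- by apply/asboolP; exists 1; rewrite rmorph1.
- have [c' fc] := fk c; apply/asboolP; exists (c' * x' + y').
  by rewrite rmorphD rmorphM fc mulr_algl.
- by apply/asboolP; exists (x' * y'); rewrite rmorphM.
Qed.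

(** * A Nullstellensatz in countably many variables *)

Lemma uncountable_fiber (T : Type) (D : countType) (f : T -> D) :
  ~ countable [set: T] -> exists d, infinite_set (f @^-1` [set d]).
Proof.
move=> ncT; apply: contrapT => nex; apply: ncT.
have -> : [set: T] = \bigcup_(d in [set: D]) f @^-1` [set d].
  by apply/seteqP; split=> t _ //; exists (f t).
apply: bigcup_countable => [|d _]; first exact: countableP.
by apply: finite_set_countable; apply: contrapT => infd; apply: nex; exists d.
Qed.

Section AvoidingIdeals.
Variables (R : comNzRingType) (I : set R) (D : Type) (w : D -> R).
Hypotheses (idI : is_ideal I) (I1 : ~ I 1).
Hypothesis primeI : forall a b, I (a * b) -> I a \/ I b.
Hypothesis wI : forall d, ~ I (w d).

Let W (s : seq D) : R := \prod_(d <- s) w d.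

(** Zorn's lemma.  The maximal ideals avoiding the products of the [w d] are the
    maximal ideals of a localization; the last clause states, without denominators,
    that an element outside such an ideal becomes invertible modulo it. *)
Lemma maximal_avoiding_ideal : exists m : set R,
  [/\ is_ideal m, I `<=` m, forall s, ~ m (W s)
    & forall a, ~ m a -> exists s u, m (W s - u * a)].
Proof.
pose good (m : set R) := [/\ is_ideal m, I `<=` m & forall s, ~ m (W s)].
have goodI : good I.
  split=> //; elim=> [|d s IHs]; rewrite /W; first by rewrite big_nil.
  by rewrite big_cons => /primeI[/wI|/IHs].
have [|m [Pm maxm]] := @Zorn_bigcup _ (fun m => m = set0 \/ good m).
  move=> F FP totF.
  have [[m0 Fm0 gm0]|nogood] := pselect (exists2 m, F m & good m); last first.
    left; rewrite predeqE => a; split=> // -[m Fm ma].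
    by case: (FP _ Fm) => [m0|gm]; [rewrite -m0|apply: nogood; exists m].
  right; split.
  - have [[m00 _ _] Im0 _] := gm0.
    split=> [|a b [m Fm ma] [m' Fm' mb]|a b [m Fm mb]]; first by exists m0.
    + have [X [FX Xa Xb]] : exists X, [/\ F X, X a & X b].
        by have [s|s] := totF _ _ Fm Fm'; [exists m'|exists m]; split=> //; apply: s.
      exists X => //; case: (FP _ FX) => [X0|[[_ XD _] _ _]]; last exact: XD.
      by move: Xa; rewrite X0.
    + exists m => //; case: (FP _ Fm) => [m_0|[[_ _ mM] _ _]]; last exact: mM.
      by move: mb; rewrite m_0.
  - by move=> a Ia; exists m0 => //; have [_ + _] := gm0; exact.
  - move=> s [m Fm mw]; case: (FP _ Fm) => [m_0|[_ _ /(_ s)]]; last exact.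
    by move: mw; rewrite m_0.
case: Pm => [m0|gm].
  case: (maxm I); last by right.
  rewrite m0; split=> // /(_ 0); apply; by have [] := idI.
have [idm Im mW] := gm; have [m_0 mD mM] := idm; exists m; split=> // a na.
pose B := [set x | exists u, m (x - u * a)].
have mB : m `<=` B by move=> x mx; exists 0; rewrite mul0r subr0.
apply: contrapT => nB; apply: (maxm B).
  split=> // Bm; apply: na; apply: Bm; exists 1; by rewrite mul1r subrr.
right; split; last first.
- by move=> s [u Bu]; apply: nB; exists s, u.
- by move=> x /Im /mB.
split=> [|x y [u mx] [v my]|b x [u mx]]; first exact: mB.
- exists (u + v); rewrite mulrDl opprD addrACA; exact: mD.
- by exists (b * u); rewrite -mulrA -mulrBr; exact: mM.
Qed.

End AvoidingIdeals.

Lemma linear_dependence (k : fieldType) (V : lmodType k) (n : nat)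
    (e : 'I_n -> V) (u : 'I_n.+1 -> V) :
  (forall i, exists c : 'I_n -> k, u i = \sum_j c j *: e j) ->
  exists2 v : 'I_n.+1 -> k, exists i, v i != 0 & \sum_i v i *: u i = 0.
Proof.
move=> /choice[c uE]; pose M := \matrix_(i, j) c i j.
have : kermx M != 0.
  rewrite -mxrank_eq0 mxrank_ker subn_eq0 -ltnNge ltnS; exact: rank_leq_col.
case/rowV0Pn => v /sub_kermxP vM v0; exists (v 0).
  by apply/existsP; rewrite -negb_forall; apply: contra_neqN v0 => /forallP v0;
     apply/rowP => i; rewrite mxE; apply/eqP; apply: v0.
under eq_bigr => i _ do rewrite uE scaler_sumr.
rewrite exchange_big big1//= => j _.
under eq_bigr => i _ do rewrite scalerA.
rewrite -scaler_suml; have /matrixP/(_ 0 j) := vM; rewrite !mxE => vMj.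
rewrite (eq_bigr (fun i => v 0 i * M i j)) ?vMj ?scale0r// => i _.
by rewrite mxE.
Qed.

Section CountableNullstellensatz.
Variables (k : closedFieldType) (R : comAlgType k) (C : countType) (e : C -> R).
Hypothesis uncountable_k : ~ countable [set: k].
Hypothesis spanR : forall r, exists s : seq (k * C), r = \sum_(p <- s) p.1 *: e p.2.
Variables (I : set R) (D : countType) (w : D -> R).
Hypotheses (idI : is_ideal I) (I1 : ~ I 1).
Hypothesis primeI : forall a b, I (a * b) -> I a \/ I b.
Hypothesis wI : forall d, ~ I (w d).

(** Let [m] be maximal among the ideals that contain [I] and avoid the products of
    the [w d].  It is prime, and it suffices that each [r] in [R] is congruent to a
    constant modulo [m].  Otherwise, for every [c] in [k], some [u c] is an inverse
    of [r - c] modulo [m], up to a product of the [w d].  As [k] is uncountable and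
    [R] has countable dimension, infinitely many [c] share this product and a finite
    set of generators whose span contains [u c].  A linear relation between those
    [u c], cleared of denominators, gives a nonzero polynomial [q] with [q(r)] in
    [m]; it splits over [k], so that some [r - z] lies in [m] after all. *)
Lemma countable_nullstellensatz : exists phi : {lrmorphism R -> k^o},
  (forall a, I a -> phi a = 0) /\ (forall d, phi (w d) != 0).
Proof.
have [m [idm Im mW max_m]] := maximal_avoiding_ideal idI I1 primeI wI.
have [m0 mD mM] := idm.
have mB a b : m a -> m b -> m (a - b) by exact: idealB.
have mMr a b : m a -> m (a * b) by rewrite mulrC; exact: mM.
have m1 : ~ m 1 by move: (mW [::]); rewrite big_nil.
have prime_m a b : m (a * b) -> m a \/ m b.
  move=> mab; apply: contrapT => /not_orP[/max_m[s [u mu]] /max_m[t [v mv]]].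
  apply: (mW (s ++ t)); rewrite big_cat/=.
  set x := (X in X * _); set y := (X in _ * X).
  have -> : x * y = (x - u * a) * y + u * a * (y - v * b) + u * v * (a * b) by ring.
  by apply: (mD); [apply: (mD); [exact: mMr|exact: mM]|exact: mM].
have mS (c : k) x : m x -> m (c *: x) by rewrite -[c *: x]mulr_algl; exact: mM.
have mZ (c : k) x : c != 0 -> m (c *: x) -> m x.
  by move=> c0 mcx; rewrite -(scalerK c0 x); exact: mS.
have surj r : exists c : k, m (r - c%:A).
  apply: contrapT => /forallNP nc.
  have /choice[a aP] (c : k) : exists a : seq (k * C) * seq D,
      m (\prod_(d <- a.2) w d - (\sum_(p <- a.1) p.1 *: e p.2) * (r - c%:A)).
    have [t [u mu]] := max_m _ (nc c); have [s uE] := spanR u.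
    by exists (s, t); rewrite /= -uE.
  (* The relation needs one more [c] than there are generators in [L]. *)
  have [[L t] infL] := uncountable_fiber (fun c => (map snd (a c).1, (a c).2))
    uncountable_k.
  have [X XL szX] := infinite_set_fset (size L).+1 infL.
  pose c (i : 'I_(size L).+1) : k := nth 0 X i.
  have cX i : c i \in X by rewrite mem_nth// (leq_trans (ltn_ord i)).
  have c_inj i j : c i = c j -> i = j.
    move=> /eqP; rewrite nth_uniq ?fset_uniq// ?(leq_trans (ltn_ord _))//.
    by move=> /eqP/val_inj.
  have cL i : map snd (a (c i)).1 = L /\ (a (c i)).2 = t.
    by have /= [-> ->] := XL _ (cX i).
  pose u i := \sum_(p <- (a (c i)).1) p.1 *: e p.2.
  have mu i : m (\prod_(d <- t) w d - u i * (r - (c i)%:A)).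
    by have := aP (c i); have [_ ->] := cL i.
  have [|v [i0 vi0] vu] := @linear_dependence k R (size L)
      (fun j => e (tnth (in_tuple L) j)) u.
    move=> i; have [LE _] := cL i.
    have szL : size (a (c i)).1 = size L by rewrite -LE size_map.
    case EL : L => [|x0 L'].
      by exists (fun=> 0); rewrite /u (size0nil (etrans szL _)) ?EL// big_nil big_ord0.
    rewrite -EL in szL *.
    exists (fun j => (nth (0, x0) (a (c i)).1 j).1).
    rewrite /u (big_nth (0, x0)) szL big_mkord; apply: eq_bigr => j _.
    rewrite (tnth_nth x0)/=; congr (_ *: e _).
    by rewrite -(nth_map (0, x0) x0 snd) ?szL// LE.
  (* Multiplying the relation by all [r - c j] turns [u i] into the product of *)
  (* the factors other than the [i]-th one.                                     *)
  pose q : {poly k} := \sum_i v i *: \prod_(j | j != i) ('X - (c j)%:P).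
  have q0 : q != 0.
    apply/eqP => q0; have : q.[c i0] = 0 by rewrite q0 horner0.
    rewrite horner_sum (bigD1 i0)//= [X in _ + X]big1 => [|i ii0]; last first.
      rewrite hornerZ horner_prod (bigD1 i0) 1?eq_sym//= hornerXsubC subrr mul0r.
      by rewrite mulr0.
    rewrite addr0 hornerZ horner_prod => /eqP; rewrite mulf_eq0 (negPf vi0)/=.
    apply/negP; apply/prodf_neq0 => j ji0; rewrite hornerXsubC subr_eq0.
    by apply: contra_neq ji0 => /c_inj.
  have ev z : horner_alg r ('X - z%:P) = r - z%:A.
    by rewrite rmorphB/= horner_algX horner_algC.
  have mwq : m (\prod_(d <- t) w d * horner_alg r q).
    pose P := \prod_j (r - (c j)%:A).
    have -> : \prod_(d <- t) w d * horner_alg r q =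
        \sum_i v i *: ((\prod_(d <- t) w d - u i * (r - (c i)%:A)) *
                        \prod_(j | j != i) (r - (c j)%:A)).
      rewrite linear_sum mulr_sumr.
      rewrite [RHS](_ : _ = \sum_i (v i *: (\prod_(d <- t) w d *
            \prod_(j | j != i) (r - (c j)%:A)) - (v i *: u i) * P)).
        rewrite sumrB -mulr_suml vu mul0r subr0; apply: eq_bigr => i _.
        rewrite linearZ/= scalerAr rmorph_prod mulr_algl; congr (_ * (_ *: _)).
        by apply: eq_bigr => j _; exact: ev.
      apply: eq_bigr => i _; rewrite mulrBl scalerBr; congr (_ - _).
      by rewrite -scalerAl -mulrA /P [in RHS](bigD1 i).
    apply: (big_ind m) => // i _; apply: mS; exact: mMr.
  have /prime_m[/mW//|] := mwq; have [rs qE] := closed_field_poly_normal q.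
  rewrite qE linearZ/= mulr_algl => /mZ; rewrite lead_coef_eq0 => /(_ q0).
  elim: rs {qE} => [|z rs IHrs]; first by rewrite big_nil rmorph1.
  rewrite big_cons rmorphM/= ev => /prime_m[|//].
  exact: nc.
have [f fP] := choice surj.
have uniq r c : m (r - c%:A) -> f r = c.
  move=> mc; apply/eqP; rewrite -subr_eq0; apply: contrapT => /negP fc; apply: m1.
  apply: mZ fc _; rewrite scalerBl.
  have -> : (f r)%:A - c%:A = (r - c%:A) - (r - (f r)%:A) :> R by ring.
  exact: mB.
have [|||phi phiE] := @lrmorphism_of_fun k R (k^o : comAlgType k) f.
- move=> x y; apply: uniq; rewrite scalerDl opprD addrACA; exact: mD.
- split=> [|x y]; apply: uniq; first by rewrite scale1r subrr.
  have -> : x * y - (f x * f y)%:A = x * (y - (f y)%:A) + (f y)%:A * (x - (f x)%:A).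
    have -> : (f x * f y)%:A = (f x)%:A * (f y)%:A :> R.
      by rewrite mulr_algl scalerA.
    by ring.
  by apply: (mD); exact: mM.
- move=> c x; apply: uniq; rewrite -scalerA -scalerBr; exact: mS.
exists phi; split=> [a Ia|d]; rewrite phiE.
  by apply: uniq; rewrite scale0r subr0; exact: Im.
apply/eqP => wd; have := fP (w d); rewrite wd scale0r subr0.
by have := mW [:: d]; rewrite big_seq1.
Qed.

End CountableNullstellensatz.

(** * Localization and ultrafilters of rational points *)

(** [S] consists of the fractions [q / w ^ n] seen as functions on the set of rational
    points of [Q] where [w] does not vanish; it is the image of the localization of
    [Q] at [w] in the functions on this set. *)
Lemma localization_exists (k : fieldType) (Q : comAlgType k) (w : Q) :
  (exists phi : {lrmorphism Q -> k^o}, phi w != 0) ->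
  exists (S : comAlgType k) (l : {lrmorphism Q -> S}),
  [/\ exists b, l w * b = 1,
      forall s, exists q n, s * l w ^+ n = l q
    & forall phi : {lrmorphism Q -> k^o}, phi w != 0 ->
        exists psi : {lrmorphism S -> k^o}, forall q, psi (l q) = phi q].
Proof.
pose V := {phi : {lrmorphism Q -> k^o} | phi w != 0}.
case=> phi0 phi0w; have inhV : inhabited V by constructor; exists phi0.
have [P [ev [ev_inj ev_surj]]] := function_algebra k inhV.
have [h hE] := function_algebra_lift (fun phi : V => sval phi) ev_inj ev_surj.
pose fraction : {pred P} := fun f => `[< exists q n, f * h w ^+ n = h q >].
have algF : GRing.subalg_closed fraction.
  split=> [|c f g|f g].
  - by apply/asboolP; exists 1, 0%N; rewrite expr0 mulr1 rmorph1.
  - move=> /asboolP[q [m fE]] /asboolP[r [n gE]]; apply/asboolP.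
    (* The numerator of [c * q / w ^ m + r / w ^ n] over [w ^ (m + n)]. *)
    exists (c *: (q * w ^+ n) + r * w ^+ m), (m + n)%N.
    rewrite linearP !rmorphM !rmorphXn/= -fE -gE exprD.
    rewrite -[c *: f]mulr_algl -[X in _ = X + _]mulr_algl; move: c%:A => d; ring.
  - move=> /asboolP[q [m fE]] /asboolP[r [n gE]]; apply/asboolP.
    exists (q * r), (m + n)%N; rewrite rmorphM/= -fE -gE exprD.
    exact: mulrACA.
have [S [i [i_inj iF Fi]]] := subalgebra algF.
have [|l lE] := @lrmorphism_lift _ _ _ _ i h i_inj.
  by move=> q; apply: Fi; apply/asboolP; exists q, 0%N; rewrite expr0 mulr1.
exists S, l; split=> [|s|phi phiw].
- have [g gE] := ev_surj (fun phi => (sval phi w)^-1).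
  have hwg : h w * g = 1.
    by apply: ev_inj => phi; rewrite rmorphM rmorph1/= gE hE; exact: divff (svalP phi).
  have [|b bE] := Fi g.
    by apply/asboolP; exists 1, 1%N; rewrite rmorph1 expr1 mulrC.
  by exists b; apply: i_inj; rewrite rmorphM rmorph1/= lE bE.
- have /asboolP[q [n sE]] := iF s; exists q, n; apply: i_inj.
  by rewrite rmorphM rmorphXn/= !lE.
- exists (ev (exist _ phi phiw) \o i : {lrmorphism _ -> _}) => q /=.
  by rewrite lE hE.
Qed.

Lemma unit_ideal_pointP (k : fieldType) (Q : comAlgType k) (E : set Q)
    (f : {lrmorphism Q -> k^o}) :
  unit_ideal (f @` E) <-> exists2 e, E e & f e != 0.
Proof.
split=> [[s [sE s1]]|[e Ee fe0]].
  apply: contrapT => nE; move/eqP: s1; rewrite big1_seq => [|p /andP[_ /sE[e Ee <-]]].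
    by rewrite eq_sym oner_eq0.
  have [->|fe0] := eqVneq (f e) 0; first by rewrite mulr0.
  by case: nE; exists e.
exists [:: ((f e)^-1, f e)]; split=> [p|]; first by rewrite inE => /eqP->; exists e.
by rewrite big_seq1/= mulVf.
Qed.

Section UltraPoints.
Variables (T : Type) (U : set_system T) (ultraU : UltraFilter U).

Let Uex (P : set T) : U P -> exists t, P t. Proof. exact: filter_ex. Qed.
Let UI (P P' : set T) : U P -> U P' -> U (P `&` P'). Proof. exact: filterI. Qed.

Lemma ultraN (P : set T) : ~ U P <-> U (~` P).
Proof.
split=> [|UnP UP]; first by case: (in_ultra_setVsetC P ultraU).
by have /Uex[t []] := UI UP UnP.
Qed.

Lemma filter_seq (I : eqType) (s : seq I) (P : I -> set T) :
  (forall i, i \in s -> U (P i)) -> U [set t | forall i, i \in s -> P i t].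
Proof.
elim: s => [|i s IHs] UP; first by apply: filterS filterT.
have Us : U [set t | forall i, i \in s -> P i t].
  by apply: IHs => j js; apply: UP; rewrite inE js orbT.
apply: filterS (UI (UP i (mem_head _ _)) Us) => t [Pit Pst] j.
by rewrite inE => /predU1P[->|/Pst].
Qed.

(** An ultrafilter selects a member of any finite cover. *)
Lemma ultra_seq (I : eqType) (s : seq I) (P : I -> set T) :
  U [set t | exists2 i, i \in s & P i t] -> exists2 i, i \in s & U (P i).
Proof.
move=> UP; apply: contrapT => nP.
have /Uex[t [[i si Pit] nPt]] : U ([set t | exists2 i, i \in s & P i t] `&`
    [set t | forall i, i \in s -> (~` P i) t]).
  apply: UI => //; apply: filter_seq => i si; apply/ultraN => UPi.
  by apply: nP; exists i.
exact: (nPt i).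
Qed.

Variables (k : fieldType) (Q : comAlgType k) (p : T -> {lrmorphism Q -> k^o}).

(** Along the ultrafilter, the points [p t] converge to the prime ideal of the
    elements that vanish at almost all of them. *)
Definition null (q : Q) : Prop := U [set t | p t q = 0].

Lemma not_nullP q : ~ null q <-> U [set t | p t q != 0].
Proof.
rewrite ultraN; split; apply: filterS => t; first by move=> /eqP.
by move=> /= /eqP.
Qed.

Lemma null_ideal : is_ideal null.
Proof.
split=> [|x y|a x]; rewrite /null.
- by apply: filterS filterT => t _ /=; rewrite rmorph0.
- by move=> Ux Uy; apply: filterS (UI Ux Uy) => t [/= xt yt];
  rewrite rmorphD/= xt yt addr0.
- by apply: filterS => t /= xt; rewrite rmorphM/= xt mulr0.
Qed.

Lemma null_prime a b : null (a * b) -> null a \/ null b.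
Proof.
move=> ab; apply: contrapT => /not_orP[/not_nullP na /not_nullP nb].
have /Uex[t [[]]] := UI (UI na nb) ab.
rewrite /= rmorphM => at0 bt0 /eqP; apply/negP.
by rewrite mulf_neq0.
Qed.

Lemma null1 : ~ null 1.
Proof. by move=> /Uex[t] /= /eqP; rewrite rmorph1 oner_eq0. Qed.

(** If almost every point lies in the open set [D(E)], so does their generic limit:
    the ideal generated by [E] is finitely generated, so that [E] vanishing at the
    limit vanishes at almost every point.  Without the noetherian
    hypothesis, the unit vectors of an infinite-dimensional space, which converge to
    the origin, are a counterexample. *)
Lemma generic_unit (E : set Q) : noetherian Q ->
  U [set t | unit_ideal (p t @` E)] -> exists2 e, E e & ~ null e.
Proof.
move=> noeQ UE; apply: contrapT => nE.
have Enull : E `<=` null.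
  by move=> e Ee; apply: contrapT => ne; apply: nE; exists e.
pose I : set Q := [set x | forall J, is_ideal J -> E `<=` J -> J x].
have idI : is_ideal I.
  split=> [J [J0 _ _] //|x y Ix Iy J idJ EJ|a x Ix J idJ EJ]; have [_ JD JM] := idJ.
    by apply: JD; [exact: Ix|exact: Iy].
  by apply: JM; exact: Ix.
have [s sI Is] := noeQ I idI.
have Us : U [set t | forall x, x \in s -> p t x = 0].
  apply: filter_seq => x /sI Ix; exact: (Ix null null_ideal Enull).
have /Uex[t [/unit_ideal_pointP[e Ee /eqP]]] := UI UE Us.
rewrite /= => et st; apply: et.
apply: (Is e) (p t @^-1` [set 0]) _ st; first by move=> J _; exact.
split=> [|x y|a x]; rewrite /preimage/= ?rmorph0// ?rmorphD ?rmorphM/=.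
  by move=> -> ->; rewrite addr0.
by move=> ->; rewrite mulr0.
Qed.

End UltraPoints.

(** * Generic truth of equations between points of a variety *)

Lemma fmap_factor (k : fieldType) (F : kfunctor k) (A B C : comAlgType k)
    (g : {lrmorphism B -> C}) (f : {lrmorphism A -> B}) (h : {lrmorphism A -> C}) x :
  (forall a, g (f a) = h a) -> fmap F g (fmap F f x) = fmap F h x.
Proof.
by move=> gf; rewrite -fmap_comp; congr (fmap F _ x); exact: lrmorphism_ext.
Qed.

Lemma lrmorphism_eq_gen (k : fieldType) (A B : comAlgType k) (s : seq A)
    (f g : {lrmorphism A -> B}) :
  (forall S : {pred A}, GRing.subalg_closed S -> {subset s <= S} ->
    forall a, a \in S) ->
  (forall a, a \in s -> f a = g a) -> f = g.
Proof.
move=> genA fgs; apply: lrmorphism_ext => a; apply/asboolP.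
apply: (genA (fun a => `[< f a = g a >])) => [|b /fgs fgb]; last exact/asboolP.
split=> [|c x y /asboolP fx /asboolP fy|x y /asboolP fx /asboolP fy]; apply/asboolP.
- by rewrite !rmorph1.
- by rewrite !linearP/= fx fy.
- by rewrite !rmorphM/= fx fy.
Qed.

(** Finitely many charts cover the points with values in [k]. *)
Lemma ultra_chart (k : fieldType) (X : variety k) (T : Type) (U : set_system T)
    (c : T -> kpoints X) : UltraFilter U ->
  exists (A : comAlgType k) (j : morphism (Spec A) X),
  [/\ finitely_generated A, open_immersion j
    & U [set t | range (@mor _ _ _ j k^o) (c t)]].
Proof.
move=> ultraU; have [n [A [j [jP cover]]]] := var_cover X.
have fieldk : is_field (k^o : comAlgType k).
  by move=> a a0; exists (a^-1); exact: divff.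
have [|i _ Ui] := ultra_seq (s := enum 'I_n)
  (P := fun i => [set t | range (@mor _ _ _ (j i) k^o) (c t)]) ultraU.
  apply: filterS filterT => t _ /=.
  by have [i ri] := cover _ fieldk (c t); exists i; rewrite ?mem_enum.
by exists (A i), (j i); have [_ fgA openj] := jP i.
Qed.

Section GenericEquality.
Variables (k : fieldType) (Y : variety k) (Q : comAlgType k).
Hypothesis noeQ : noetherian Q.
Variables (T : Type) (U : set_system T) (ultraU : UltraFilter U).
Variables (p : T -> {lrmorphism Q -> k^o}) (a b : Y Q).

Let Uex (P : set T) : U P -> exists t, P t. Proof. exact: filter_ex. Qed.
Let UI (P P' : set T) : U P -> U P' -> U (P `&` P'). Proof. exact: filterI. Qed.

Let kills_null (phi : {lrmorphism Q -> k^o}) := forall q, null U p q -> phi q = 0.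

(** Choose a chart [j] containing [a] at almost all points.  If [b] leaves it almost
    everywhere, then this persists at every point of the limit locus, where the
    equations defining the complement of the chart hold.  Otherwise [a] and [b] both
    lie in the chart over a localization [S], where they become two morphisms from
    a finitely generated algebra to [S]; these agree almost everywhere, or one
    generator separates them almost everywhere.  In the last case, [w] contains the
    numerator of the difference of the two values of this generator. *)
Lemma generic_eq : exists2 w, ~ null U p w &
  forall phi, kills_null phi -> phi w != 0 ->
    (fmap Y phi a = fmap Y phi b <-> U [set t | fmap Y (p t) a = fmap Y (p t) b]).
Proof.
have [A [j [[gen genA] [j_inj openj] Ua]]] :=
  ultra_chart (fun t => fmap Y (p t) a) ultraU.
have [Ea EaP] := openj Q a; have [Eb EbP] := openj Q b.
have [|ea Eaea nea] := generic_unit ultraU (p := p) (E := Ea) noeQ.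
  by apply: filterS Ua => t; move/EaP.
have [Ub|Ub] := in_ultra_setVsetC
    [set t | range (@mor _ _ _ j k^o) (fmap Y (p t) b)] ultraU; last first.
  exists ea => // phi null_phi phi_ea.
  have phi_a : range (@mor _ _ _ j k^o) (fmap Y phi a).
    by apply/EaP/unit_ideal_pointP; exists ea.
  have phi_b : ~ range (@mor _ _ _ j k^o) (fmap Y phi b).
    move/EbP/unit_ideal_pointP => [e Ebe /eqP]; apply; apply: null_phi.
    apply: filterS Ub => t /= nt; apply/eqP; apply: contrapT => /negP pe.
    by apply: nt; apply/EbP/unit_ideal_pointP; exists e.
  split=> [ab|Uab]; first by rewrite -ab in phi_b.
  by have [t [[/= nt ab] at_]] := Uex (UI (UI Ub Uab) Ua); rewrite -ab in nt.
have [|eb Ebeb neb] := generic_unit ultraU (p := p) (E := Eb) noeQ.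
  by apply: filterS Ub => t; move/EbP.
pose w := ea * eb.
have nw : ~ null U p w by case/(null_prime ultraU).
have Uw : U [set t | p t w != 0] by apply/(not_nullP ultraU).
have [|S [l [[c wc] lfrac lext]]] := @localization_exists k Q w.
  by have [t pw] := Uex Uw; exists (p t).
have [alpha alphaE] : exists alpha : {lrmorphism A -> S}, j S alpha = fmap Y l a.
  suff /EaP[alpha _ <-] : unit_ideal (l @` Ea) by exists alpha.
  exists [:: (l eb * c, l ea)].
  split=> [q|]; first by rewrite inE => /eqP->; exists ea.
  by rewrite big_seq1/= mulrC mulrA -rmorphM.
have [beta betaE] : exists beta : {lrmorphism A -> S}, j S beta = fmap Y l b.
  suff /EbP[beta _ <-] : unit_ideal (l @` Eb) by exists beta.
  exists [:: (l ea * c, l eb)].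
  split=> [q|]; first by rewrite inE => /eqP->; exists eb.
  by rewrite big_seq1/= mulrC mulrA -rmorphM (mulrC eb).
have at_ (psi : {lrmorphism S -> k^o}) (phi : {lrmorphism Q -> k^o}) :
    (forall q, psi (l q) = phi q) ->
    fmap Y phi a = j k^o (Spec_map psi alpha) /\
    fmap Y phi b = j k^o (Spec_map psi beta).
  move=> psil; rewrite -!(fmap_factor _ psil) -alphaE -betaE.
  by rewrite -!mor_nat.
have zero_frac s q n (psi : {lrmorphism S -> k^o}) (phi : {lrmorphism Q -> k^o}) :
    s * l w ^+ n = l q -> (forall q, psi (l q) = phi q) ->
    phi w != 0 -> (psi s = 0 :> k <-> phi q = 0 :> k).
  move=> sq psil phiw; rewrite -psil -sq rmorphM rmorphXn/= psil.
  split=> [->|/eqP]; first exact: mul0r.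
  by rewrite mulf_eq0 expf_eq0 (negPf phiw) andbF orbF => /eqP.
have [Uab|Uab] := in_ultra_setVsetC
    [set t | fmap Y (p t) a = fmap Y (p t) b] ultraU.
  exists w => // phi null_phi phiw; split=> // _.
  have [psi psil] := lext phi phiw; have [-> ->] := at_ _ _ psil.
  congr (j k^o _); apply: lrmorphism_ext => x /=; apply/eqP; rewrite -subr_eq0 -raddfB.
  have [q [n sq]] := lfrac (alpha x - beta x).
  apply/eqP/(zero_frac _ _ _ _ _ sq psil phiw)/null_phi.
  apply: filterS (UI Uw Uab) => t [/= ptw ptab].
  have [psit psitl] := lext _ ptw; apply/(zero_frac _ _ _ _ _ sq psitl ptw).
  have [ata atb] := at_ _ _ psitl; have /j_inj := etrans (esym ata) (etrans ptab atb).
  move=> /(congr1 (fun f : {lrmorphism A -> k^o} => f x)) /= psix.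
  by rewrite raddfB/= psix subrr.
have [|x _ Ux] := ultra_seq (s := gen) (P := fun x =>
    [set t | exists2 psi : {lrmorphism S -> k^o}, forall q, psi (l q) = p t q &
       psi (alpha x - beta x) <> 0]) ultraU.
  apply: filterS (UI Uw Uab) => t [/= ptw ptab].
  have [psi psil] := lext _ ptw; have [ata atb] := at_ _ _ psil.
  apply: contrapT => neq; apply: ptab; rewrite ata atb; congr (j k^o _).
  apply: (lrmorphism_eq_gen genA) => x sx; apply: contrapT => nx; apply: neq.
  exists x => //; exists psi => // /eqP; rewrite raddfB subr_eq0 => /eqP; exact: nx.
have [q [n sq]] := lfrac (alpha x - beta x).
have nq : ~ null U p q.
  move=> /(UI Ux)/(UI Uw)/Uex[t [ptw [[psi psil psix] ptq]]]; apply: psix.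
  exact/(zero_frac _ _ _ _ _ sq psil ptw).
exists (w * q); first by case/(null_prime ultraU).
move=> phi null_phi; rewrite rmorphM mulf_eq0 negb_or => /andP[phiw phiq].
split=> [phiab|/UI/(_ Uab)/Uex[t []//]].
have [psi psil] := lext phi phiw; have [ata atb] := at_ _ _ psil.
have /j_inj := etrans (esym ata) (etrans phiab atb).
move=> /(congr1 (fun f : {lrmorphism A -> k^o} => f x)) /= psix.
case/eqP: phiq; apply/(zero_frac _ _ _ _ _ sq psil phiw).
by rewrite raddfB/= psix subrr.
Qed.

End GenericEquality.

(** * Countable saturation *)

Definition generates (k : fieldType) (A : comAlgType k) (F : set A) : Prop :=
  forall S : {pred A}, GRing.subalg_closed S -> (forall a, F a -> a \in S) ->
    forall a, a \in S.

Lemma generated_subalgebra (k : fieldType) (P : comAlgType k) (F : set P) :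
  exists (B : comAlgType k) (i : {lrmorphism B -> P}),
    [/\ injective i, forall a, F a -> exists b, i b = a & generates (i @^-1` F)].
Proof.
pose gen : {pred P} := fun a => `[< forall S : {pred P},
  GRing.subalg_closed S -> (forall b, F b -> b \in S) -> a \in S >].
have alg_gen : GRing.subalg_closed gen.
  split=> [|c x y /asboolP gx /asboolP gy|x y /asboolP gx /asboolP gy]; apply/asboolP.
  - by move=> S [].
  - by move=> S algS FS; have [_ SL _] := algS; apply: SL; [exact: gx|exact: gy].
  - by move=> S algS FS; have [_ _ SM] := algS; apply: SM; [exact: gx|exact: gy].
have [B [i [i_inj i_gen gen_i]]] := subalgebra alg_gen.
exists B, i; split=> // [a Fa|S algS FS b].
  by apply: gen_i; apply/asboolP => S _; exact.
pose S' : {pred P} := fun a => `[< exists2 b, b \in S & i b = a >].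
have algS' : GRing.subalg_closed S'.
  have [S1 SL SM] := algS.
  split=> [|c x y|x y]; first by apply/asboolP; exists 1; rewrite ?rmorph1.
  - move=> /asboolP[x' Sx <-] /asboolP[y' Sy <-]; apply/asboolP.
    by exists (c *: x' + y'); rewrite ?linearP//; exact: SL.
  - move=> /asboolP[x' Sx <-] /asboolP[y' Sy <-]; apply/asboolP.
    by exists (x' * y'); rewrite ?rmorphM//; exact: SM.
have /asboolP/(_ S' algS') gen_ib := i_gen b.
suff /gen_ib/asboolP[b' Sb' /i_inj <-] : forall a, F a -> a \in S' by [].
move=> a Fa; have [|c ca] := gen_i a; first by apply/asboolP => S'' _; exact.
by apply/asboolP; exists c => //; apply: FS; rewrite /preimage/= ca.
Qed.

Lemma generates_lift (k : fieldType) (A B P : comAlgType k) (F : set A)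
    (f : {lrmorphism A -> P}) (i : {lrmorphism B -> P}) :
  generates F -> injective i -> (forall a, F a -> exists b, i b = f a) ->
  exists g : {lrmorphism A -> B}, forall a, i (g a) = f a.
Proof.
move=> genF i_inj Fi; apply: lrmorphism_lift => // a; apply/asboolP.
apply: (genF (fun a => `[< exists b, i b = f a >])) => [|c /Fi ?]; last exact/asboolP.
split=> [|c x y|x y]; first by apply/asboolP; exists 1; rewrite !rmorph1.
- move=> /asboolP[x' xE] /asboolP[y' yE]; apply/asboolP.
  by exists (c *: x' + y'); rewrite !linearP/= xE yE.
- move=> /asboolP[x' xE] /asboolP[y' yE]; apply/asboolP.
  by exists (x' * y'); rewrite !rmorphM/= xE yE.
Qed.

Lemma span_monomials (k : fieldType) (A : comAlgType k) (D : Type) (x : D -> A) :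
  generates (range x) ->
  forall a, exists s : seq (k * seq D), a = \sum_(p <- s) p.1 *: \prod_(d <- p.2) x d.
Proof.
move=> genx a; apply/asboolP.
pose S : {pred A} := fun a =>
  `[< exists s : seq (k * seq D), a = \sum_(p <- s) p.1 *: \prod_(d <- p.2) x d >].
apply: (genx S) => [|_ [d _ <-]]; last first.
  by apply/asboolP; exists [:: (1, [:: d])]; rewrite !big_seq1 scale1r.
split=> [|c b1 b2 /asboolP[s ->] /asboolP[t ->]|b1 b2 /asboolP[s ->] /asboolP[t ->]].
- by apply/asboolP; exists [:: (1, [::])]; rewrite big_seq1 big_nil scale1r.
- apply/asboolP; exists ([seq (c * p.1, p.2) | p <- s] ++ t).
  rewrite big_cat big_map/= scaler_sumr; congr (_ + _).
  by apply: eq_bigr => p _; rewrite scalerA.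
- apply/asboolP; exists [seq (p.1 * q.1, p.2 ++ q.2) | p <- s, q <- t].
  rewrite big_allpairs_dep mulr_suml; apply: eq_bigr => p _.
  rewrite mulr_sumr; apply: eq_bigr => q _ /=.
  by rewrite big_cat/= -scalerAl -scalerAr scalerA.
Qed.

(** An equation compares the values of one morphism on two finite families of
    components of a point of [X^I]. *)
Record equation (k : fieldType) (X : variety k) (I : Type) := Equation {
  eqn_index : finType;
  eqn_target : variety k;
  eqn_mor : morphism (power X eqn_index) eqn_target;
  eqn_lhs : eqn_index -> I;
  eqn_rhs : eqn_index -> I }.
Arguments eqn_lhs {k X I} e _ : rename.
Arguments eqn_rhs {k X I} e _ : rename.

Definition solves (k : fieldType) (X : variety k) (I : Type) (E : equation X I)
    (z : I -> kpoints X) : Prop :=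
  @mor _ _ _ (eqn_mor E) k^o (z \o eqn_lhs E) =
  @mor _ _ _ (eqn_mor E) k^o (z \o eqn_rhs E).

(** A family of rational points is, almost everywhere, the family of values of a
    single point over a finitely generated algebra of functions of the parameter. *)
Lemma ultra_point (k : fieldType) (X : variety k) (T : Type) (U : set_system T)
    (P : comAlgType k) (ev : T -> {lrmorphism P -> k^o}) (c : T -> kpoints X) :
  UltraFilter U ->
  (forall f g, (forall t, ev t f = ev t g) -> f = g) ->
  (forall h : T -> k, exists f, forall t, ev t f = h t) ->
  exists y : {A : comAlgType k & ({lrmorphism A -> P} * X A)%type},
    finitely_generated (projT1 y) /\
    U [set t | fmap X (ev t \o (projT2 y).1 : {lrmorphism _ -> k^o}) (projT2 y).2 = c t].
Proof.
move=> ultraU ev_inj ev_surj.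
have [A [j [fgA _ Uc]]] := ultra_chart c ultraU.
have [t0 [a0 _ _]] := @filter_ex _ _ _ _ Uc.
have /choice[a aP] t : exists a : {lrmorphism A -> k^o},
    range (@mor _ _ _ j k^o) (c t) -> j k^o a = c t.
  have [[a _ <-]|nr] := pselect (range (@mor _ _ _ j k^o) (c t)); first by exists a.
  by exists a0.
have [alpha alphaE] := function_algebra_lift a ev_inj ev_surj.
exists (existT _ A (alpha, j A (idfun : {lrmorphism A -> A}))); split=> //=.
apply: filterS Uc => t /aP ct /=; rewrite -ct -mor_nat; congr (j k^o _).
by apply: lrmorphism_ext => x /=; exact: alphaE.
Qed.

Section Saturation.
Variables (k : closedFieldType) (X : variety k) (I : Type) (enumI : nat -> I).
Hypothesis uncountable_k : ~ countable [set: k].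
Hypothesis enumI_surj : forall i, exists n, enumI n = i.
Variables (T : Type) (U : set_system T) (ultraU : UltraFilter U).
Variables (D : countType) (E : D -> equation X I) (z : T -> I -> kpoints X).

(** The components of the family are almost everywhere values of points [x i] over
    algebras [A i] mapping to the functions [P] on [T].  The images of the [A i]
    generate a countably generated subalgebra [R] of [P], and each equation, which
    involves finitely many components, lives over a finitely generated subalgebra
    [Q] of [R], where [generic_eq] yields an element to be kept nonzero. *)
Lemma saturation : exists zeta : I -> kpoints X, forall d,
  solves (E d) zeta <-> U [set t | solves (E d) (z t)].
Proof.
have inhT : inhabited T.
  by have [t _] := @filter_ex _ U _ _ filterT; constructor.
have [P [ev [ev_inj ev_surj]]] := function_algebra k inhT.
have [y yP] := choice (fun i => ultra_point (fun t => z t i) ultraU ev_inj ev_surj).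
pose A i := projT1 (y i).
pose alpha i : {lrmorphism A i -> P} := (projT2 (y i)).1.
pose x i : X (A i) := (projT2 (y i)).2.
have xP i : U [set t | fmap X (ev t \o alpha i : {lrmorphism _ -> k^o}) (x i) = z t i].
  by have [] := yP i.
have [L LP] : exists L : I -> seq P, forall i (B : comAlgType k)
    (u : {lrmorphism B -> P}), injective u ->
    (forall a, a \in L i -> exists b, u b = a) ->
    exists g : {lrmorphism A i -> B}, forall a, u (g a) = alpha i a.
  suff /choice[L LP] : forall i, exists L : seq P, forall (B : comAlgType k)
      (u : {lrmorphism B -> P}), injective u ->
      (forall a, a \in L -> exists b, u b = a) ->
      exists g : {lrmorphism A i -> B}, forall a, u (g a) = alpha i a by exists L.
  move=> i; have [[s gens] _] := yP i; exists [seq alpha i a | a <- s].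
  move=> B u u_inj Lu.
  have gen_s : generates [set` s] by move=> S algS sS; apply: gens => // b /sS.
  by apply: (generates_lift gen_s) => // a sa; apply: Lu; exact: map_f.
pose coord (c : nat * nat) : P := nth 0 (L (enumI c.1)) c.2.
have L_coord i a : a \in L i -> range coord a.
  move=> La; have [n ni] := enumI_surj i; exists (n, index a (L i)) => //.
  by rewrite /coord/= ni nth_index.
have [R [iR [iR_inj coordR genR]]] := generated_subalgebra (range coord).
have /choice[coord' coordE] (c : nat * nat) : exists r, iR r = coord c.
  by apply: coordR; exists c.
have span : forall r, exists s : seq (k * seq (nat * nat)),
    r = \sum_(p <- s) p.1 *: \prod_(d <- p.2) coord' d.
  apply: span_monomials => S algS coordS r; apply: genR => // {}r [c _ cr].
  by apply: coordS; exists c => //; apply: iR_inj; rewrite coordE.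
have beta_ex i : exists g : {lrmorphism A i -> R}, forall a, iR (g a) = alpha i a.
  by apply: LP => // a /L_coord; exact: coordR.
pose beta i := sval (cid (beta_ex i)).
have betaE i a : iR (beta i a) = alpha i a := svalP (cid (beta_ex i)) a.
pose p t : {lrmorphism R -> k^o} := ev t \o iR.
pose zeta (phi : {lrmorphism R -> k^o}) i : kpoints X :=
  fmap X (phi \o beta i : {lrmorphism _ -> _}) (x i).
have /choice[w wP] d : exists w : R, ~ null U p w /\
    forall phi : {lrmorphism R -> k^o}, (forall r, null U p r -> phi r = 0) ->
      phi w != 0 -> (solves (E d) (zeta phi) <-> U [set t | solves (E d) (z t)]).
  pose J := eqn_index (E d); pose lhs := eqn_lhs (E d); pose rhs := eqn_rhs (E d).
  pose s := flatten [seq L (lhs j) ++ L (rhs j) | j <- enum J].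
  have [Q [iQ [iQ_inj sQ genQ]]] := generated_subalgebra [set` s].
  have noeQ : noetherian Q.
    have [s' ss'] : exists s' : seq Q, map iQ s' = s.
      elim: s sQ {genQ} => [|a s IHs] sQ; first by exists [::].
      have [|b ba] := sQ a; first by rewrite /= inE eqxx.
      have [|s' <-] := IHs; last by exists (b :: s'); rewrite /= ba.
      by move=> c cs; apply: sQ; rewrite /= inE cs orbT.
    apply: noetherian_fg; exists s' => S algS s'S; apply: genQ => // b.
    by rewrite /preimage/= -ss' (mem_map iQ_inj); exact: s'S.
  have liftQ i : {subset L i <= s} ->
      exists g : {lrmorphism A i -> Q}, forall a, iQ (g a) = alpha i a.
    by move=> Ls; apply: LP => // a /Ls; exact: sQ.
  have lhsQ j : exists g : {lrmorphism A (lhs j) -> Q}, forall a, iQ (g a) = alpha _ a.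
    apply: liftQ => a La; apply/flatten_mapP; exists j; first by rewrite mem_enum.
    by rewrite mem_cat La.
  have rhsQ j : exists g : {lrmorphism A (rhs j) -> Q}, forall a, iQ (g a) = alpha _ a.
    apply: liftQ => a La; apply/flatten_mapP; exists j; first by rewrite mem_enum.
    by rewrite mem_cat La orbT.
  pose ql j := sval (cid (lhsQ j)); pose qr j := sval (cid (rhsQ j)).
  have qlE j a : iQ (ql j a) = alpha _ a := svalP (cid (lhsQ j)) a.
  have qrE j a : iQ (qr j a) = alpha _ a := svalP (cid (rhsQ j)) a.
  have [kappa kappaE] : exists g : {lrmorphism Q -> R}, forall q, iR (g q) = iQ q.
    apply: (generates_lift genQ) => // q /flatten_mapP[j _].
    by rewrite mem_cat => /orP[] /L_coord; exact: coordR.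
  pose pQ t : {lrmorphism Q -> k^o} := ev t \o iQ.
  pose eta := eqn_mor (E d).
  pose a : eqn_target (E d) Q := @mor _ _ _ eta Q (fun j => fmap X (ql j) (x (lhs j))).
  pose b : eqn_target (E d) Q := @mor _ _ _ eta Q (fun j => fmap X (qr j) (x (rhs j))).
  have [wQ nwQ wQP] := generic_eq noeQ ultraU pQ a b.
  have null_kappa q : null U p (kappa q) = null U pQ q.
    by rewrite /null; congr (U _); apply/funext => t; rewrite /= kappaE.
  exists (kappa wQ); rewrite null_kappa; split=> // phi null_phi phiw.
  have [|//|abl abr] := wQP (phi \o kappa : {lrmorphism _ -> _}).
    by move=> q nq; apply: null_phi; rewrite null_kappa.
  have aE : fmap _ (phi \o kappa : {lrmorphism _ -> _}) a =
      @mor _ _ _ eta k^o (zeta phi \o lhs).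
    rewrite -mor_nat; congr (@mor _ _ _ eta k^o _); apply/funext => j.
    apply: fmap_factor => c /=; congr (phi _); apply: iR_inj.
    by rewrite kappaE qlE betaE.
  have bE : fmap _ (phi \o kappa : {lrmorphism _ -> _}) b =
      @mor _ _ _ eta k^o (zeta phi \o rhs).
    rewrite -mor_nat; congr (@mor _ _ _ eta k^o _); apply/funext => j.
    apply: fmap_factor => c /=; congr (phi _); apply: iR_inj.
    by rewrite kappaE qrE betaE.
  have Uz : U [set t | forall j, j \in enum J ->
      fmap X (ev t \o alpha (lhs j) : {lrmorphism _ -> _}) (x (lhs j)) = z t (lhs j) /\
      fmap X (ev t \o alpha (rhs j) : {lrmorphism _ -> _}) (x (rhs j)) = z t (rhs j)].
    by apply: (filter_seq ultraU) => j _; exact: (filterI (xP (lhs j)) (xP (rhs j))).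
  have Uab : U [set t | fmap _ (pQ t) a = @mor _ _ _ eta k^o (z t \o lhs) /\
                        fmap _ (pQ t) b = @mor _ _ _ eta k^o (z t \o rhs)].
    apply: filterS Uz => t zt; rewrite /= -!mor_nat.
    split; congr (@mor _ _ _ eta k^o _); apply/funext => j;
      have [zl zr] := zt j (mem_enum _ _); [rewrite /= -zl|rewrite /= -zr];
      apply: fmap_factor => c /=; congr (ev t _); [exact: qlE|exact: qrE].
  rewrite /solves -aE -bE; split=> [/abl Ut|Ut].
    by apply: filterS (filterI Uab Ut) => t [/= [<- <-]].
  by apply: abr; apply: filterS (filterI Uab Ut) => t [/= [-> ->]].
have [|phi [null_phi phiw]] := @countable_nullstellensatz k R _
  (fun l : seq (nat * nat) => \prod_(c <- l) coord' c) uncountable_k span _ _ w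
  (null_ideal ultraU p) (null1 ultraU (p := p)) (null_prime ultraU (p := p)).
  by move=> d; have [] := wP d.
by exists (zeta phi) => d; have [_ wdP] := wP d; apply: wdP.
Qed.
End Saturation.

(** * Inverting an injective cellular automaton *)

Lemma countable_enum (I : Type) (i0 : I) : countable [set: I] ->
  exists e : nat -> I, forall i, exists n, e n = i.
Proof.
move=> /countable_injP[f f_inj].
have /choice[e eP] n : exists i, (exists i', f i' = n) -> f i = n.
  by have [[i fi]|ni] := pselect (exists i', f i' = n); [exists i|exists i0].
exists e => i; exists (f i); apply: f_inj; rewrite ?inE//; apply: eP; by exists i.
Qed.

Lemma cofinal_ultrafilter (T : choiceType) : exists U : set_system {fset T},
  UltraFilter U /\ forall x, U [set N : {fset T} | x \in N].
Proof.
pose F : set_system {fset T} := [set B | exists N, forall N', fsubset N N' -> B N'].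
have properF : ProperFilter F.
  apply: Build_ProperFilter_ex => [B [N BN]|]; first by exists N; exact: BN.
  split=> [|B C [N BN] [N' CN']|B C BC [N BN]].
  - by exists fset0.
  - exists (N `|` N')%fset => N'' /[!fsubUset] /andP[NN'' N'N''].
    by split; [exact: BN|exact: CN'].
  - by exists N => N' /BN /BC.
have [U [ultraU FU]] := ultraFilterLemma properF.
exists U; split=> // x; apply: FU; exists [fset x]%fset => N' /=.
by rewrite fsub1set.
Qed.

Definition power_proj (k : fieldType) (F : kfunctor k) (I : Type) (i : I) :
  morphism (power F I) F :=
  @Morphism k (power F I) F (fun _ x => x i) (fun _ _ _ _ => erefl).

Section InverseAutomaton.
Variables (G : monoidType) (k : closedFieldType) (X Y : variety k).
Variables (tau : (G -> kpoints X) -> (G -> kpoints Y)).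
Hypothesis injtau : injective tau.
Variables (M : {fset G}) (mu : morphism (power X M) Y).
Hypothesis tauE : forall x g, tau x g = mu (k^o) (restr M (shift g x)).

(** The ultrafilter lives on the finite subsets [N] of [G], and the family consists
    of the pairs of configurations, indexed by [bool * G], that contradict the claim
    for [N].  The equations are [tau x g = tau y g] for [g] in [G], each of which
    holds for the [N] containing [g], and [x 1 = y 1], which holds for none. *)
Lemma local_determination : countable [set: G] -> ~ countable [set: k] ->
  exists N : {fset G}, forall x y,
    (forall n, n \in N -> tau x n = tau y n) -> x 1%g = y 1%g.
Proof.
move=> countG uncountk; apply: contrapT => nodet.
have [gam gam_surj] := countable_enum 1%g countG.
pose enumI n : bool * G := (odd n, gam n./2).
have enumI_surj i : exists n, enumI n = i.
  case: i => b g; have [n ng] := gam_surj g; exists (b + n.*2)%N.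
  by rewrite /enumI oddD odd_double addbF oddb half_bit_double ng.
have [U [ultraU Ug]] := cofinal_ultrafilter G.
have /choice[z zP] (N : {fset G}) : exists z : bool * G -> kpoints X,
    (forall n, n \in N -> tau (fun h => z (true, h)) n = tau (fun h => z (false, h)) n) /\
    z (true, 1%g) <> z (false, 1%g).
  apply: contrapT => nz; apply: nodet; exists N => x y xy; apply: contrapT => neq.
  by apply: nz; exists (fun i => if i.1 then x i.2 else y i.2).
(* The index [None] stands for the equation of the values at 1. *)
pose E (d : option nat) : equation X (bool * G) :=
  if d is Some n then
    Equation mu (fun m => (true, val m * gam n)%g) (fun m => (false, val m * gam n)%g)
  else Equation (@power_proj k X unit tt) (fun=> (true, 1%g)) (fun=> (false, 1%g)).
have [zeta zetaP] := saturation uncountk enumI_surj ultraU E z.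
have tau_eq : tau (fun h => zeta (true, h)) = tau (fun h => zeta (false, h)).
  apply/funext => g; have [n <-] := gam_surj g; rewrite !tauE.
  have [_] := zetaP (Some n); apply; apply: filterS (Ug (gam n)) => N gN.
  by have [/(_ _ gN) + _] := zP N; rewrite !tauE.
have [one _] := zetaP None.
have : U [set t | z t (true, 1%g) = z t (false, 1%g)].
  by apply: one; have := congr1 (fun f => f 1%g) (injtau tau_eq).
by move=> /(@filter_ex _ _ _ _)[N]; have [_] := zP N.
Qed.

Lemma tau_shift g x : tau (shift g x) = shift g (tau x).
Proof.
apply/funext => h; rewrite /shift !tauE; congr (mu _ _).
by apply/funext => m; rewrite /restr /shift mulgA.
Qed.

(** With [z g] a local preimage of [y] around [g], the global preimage takes the value
    [z g 1] at [g].  For [m] in [M], both [z (m * g)] and the translate of [z g] by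
    [m] have image [n |-> y (n * m * g)] on [N], so that they agree at 1. *)
Lemma range_SFT (N : {fset G}) :
  (forall x y, (forall n, n \in N -> tau x n = tau y n) -> x 1%g = y 1%g) ->
  is_SFT (range tau).
Proof.
move=> det.
pose D : {fset G} := (1%g |` (N `|` [fset (n * m)%g | n in N, m in M]))%fset.
have inD n m : n \in N -> m \in M -> (n * m)%g \in D.
  by move=> nN mM; rewrite !inE; apply/or3P/Or33/imfset2P; exists n => //; exists m.
have ND n : n \in N -> n \in D by move=> nN; rewrite !inE nN orbT.
have D1 : 1%g \in D by rewrite !inE eqxx.
have at_D (u v : G -> kpoints Y) d : restr D u = restr D v -> d \in D -> u d = v d.
  by move=> uv dD; have := congr1 (fun f => f [` dD]%fset) uv.
exists D, [set restr D (tau x) | x in setT]; apply/seteqP; split.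
  by move=> _ [x _ <-] g; exists (shift g x) => //; rewrite tau_shift.
move=> y yD.
have /choice[z zP] g : exists z, restr D (tau z) = restr D (shift g y).
  by have [z _ zE] := yD g; exists z.
exists (fun g => z g 1%g) => //; apply/funext => g.
have -> : y g = tau (z g) 1%g by rewrite (at_D _ _ _ (zP g) D1) /shift mul1g.
rewrite !tauE; congr (mu _ _); apply/funext => m; rewrite /restr /shift mulg1.
transitivity (shift (val m) (z g) 1%g); last by rewrite /shift mul1g.
apply: det => n nN; rewrite tau_shift (at_D _ _ _ (zP _) (ND n nN)) /shift.
by rewrite (at_D _ _ _ (zP g) (inD _ _ nN (valP m))) /shift mulgA.
Qed.

End InverseAutomaton.

Theorem corollaryA (G : monoidType) (k : closedFieldType) (X Y : variety k)
    (tau : (G -> kpoints X) -> (G -> kpoints Y)) :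
  countable (@setT G) ->
  ~ countable (@setT k) ->
  algebraic_cellular_automaton tau ->
  injective tau ->
  is_SFT (range tau).
Proof.
move=> countG uncountk [M [mu tauE]] injtau.
have [N detN] := local_determination injtau tauE countG uncountk.
exact: range_SFT tauE N detN.
Qed.
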